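(* $$\frac{15\sqrt{2}}{16} = \sum_{k=0}^{\infty}\left(\frac14\right)^{k}\frac{\left(\frac34\right)_k\left(\frac32\right)_k\left(\frac32\right)_k}{(1)_k\left(\frac{13}{8}\right)_k\left(\frac{17}{8}\right)_k}\,(k+1).$$
   Context: For $k\in\mathbb{N}_0$, $(\alpha)_k=\alpha(\alpha+1)\cdots(\alpha+k-1)$ is the rising factorial (Pochhammer symbol), with $(\alpha)_0=1$. *)

(* Defs.v *)
From Stdlib Require Import Reals.
From Coquelicot Require Import Coquelicot.

Open Scope R_scope.

(* Rising factorial: poch a k = a (a + 1) ... (a + k - 1). *)
Fixpoint poch (a : R) (k : nat) : R :=
  match k with
  | O => 1
  | S j => poch a j * (a + INR j)
  end.

(* Main.v *)
(** For positive [x], [y] put [z = x + y / 2] and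
    [S x y = sum_n (x)_n (y)_n (z)_n (2 z + 3 n) / (n! (x + y + 1)_(2n))];
    the series of the theorem is [S (3/4) (3/2) / 3].  A WZ pair gives
    [S x y = rho x y * S x (y + 2)], and [S x 2] telescopes to [(x + 1) (x + 2)], so
    [S x (2 + 2 m)] is explicit.  For [x <= 1] each summand increases with [y], hence
    [S x (3/2 + 2 m) <= S x (2 + 2 m) <= S x (3/2 + 2 (m + 1))].  Transporting this
    sandwich back to [m = 0] expresses [S (3/4) (3/2)] as the limit of explicit products,
    which reduce to [Q (2 m) / Q m] with [Q m = (3/4)_m / (1/4)_m].  Since [Q m] grows like
    a multiple of [sqrt m], that quotient tends to [sqrt 2]. *)

Require Import Defs.
From Stdlib Require Import Reals Lra Lia.
From Coquelicot Require Import Coquelicot.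
Open Scope R_scope.

(** * Auxiliary facts: positivity, limits of affine quotients, telescoping *)

Lemma poch_pos (a : R) (n : nat) : 0 < a -> 0 < poch a n.
Proof.
  intros Ha; induction n as [|n IH]; cbn [poch]; [lra|].
  apply Rmult_lt_0_compat; [exact IH|]. pose proof (pos_INR n); lra.
Qed.

Lemma is_lim_seq_affine_ratio (a b c d : R) :
  0 < c -> 0 < d ->
  is_lim_seq (fun n => (a * INR n + b) / (c * INR n + d)) (a / c).
Proof.
  intros Hc Hd.
  apply is_lim_seq_ext with (fun n => a / c + (b - a * d / c) * / (c * INR n + d)).
  { intros n. pose proof (pos_INR n). field. split; nra. }
  replace (Finite (a / c)) with (Finite (a / c + (b - a * d / c) * 0)) by (f_equal; ring).
  apply is_lim_seq_plus'; [apply is_lim_seq_const|].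
  apply is_lim_seq_mult'; [apply is_lim_seq_const|].
  assert (H : is_lim_seq (fun n => c * INR n + d) p_infty).
  { apply is_lim_seq_le_p_loc with (fun n => c * INR n).
    - exists O; intros n _; lra.
    - assert (H := is_lim_seq_scal_l INR c p_infty is_lim_seq_INR).
      cbn in H. destruct (Rle_dec 0 c) as [h|h]; [|exfalso; lra].
      destruct (Rle_lt_or_eq_dec 0 c h) as [h'|h']; [exact H|exfalso; lra]. }
  apply (is_lim_seq_inv _ p_infty H). discriminate.
Qed.

Lemma is_series_telescope (f g : nat -> R) :
  (forall n, f n = g n - g (S n)) -> is_lim_seq g 0 -> is_series f (g O).
Proof.
  intros Hf Hg.
  assert (Hs : forall n, sum_n f n = g O - g (S n)).
  { induction n as [|n IH].
    - rewrite sum_O. apply Hf.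
    - rewrite sum_Sn, IH, Hf. unfold plus; cbn. ring. }
  change (is_lim_seq (sum_n f) (g O)).
  apply is_lim_seq_ext with (fun n => g O - g (S n)); [intros n; symmetry; apply Hs|].
  replace (Finite (g O)) with (Finite (g O - 0)) by (f_equal; ring).
  apply is_lim_seq_minus'; [apply is_lim_seq_const|].
  apply (is_lim_seq_incr_1 g). exact Hg.
Qed.

(** * The two-parameter series and its convergence *)

(* The two denominators are the duplication of [(x + y + 1)_(2n)], with its [4^n]
   absorbing the weight. *)
Definition coef (x y : R) (n : nat) : R :=
  (1 / 4) ^ n * ((poch x n * poch y n * poch (x + y / 2) n)
                 / (poch 1 n * poch ((x + y + 1) / 2) n * poch ((x + y) / 2 + 1) n)).

Definition summand (x y : R) (n : nat) : R := coef x y n * (2 * x + y + 3 * INR n).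

Definition rho (x y : R) : R :=
  (y + 1) * (2 * x + y) / ((x + y + 1) * (x + y + 2)).

Lemma rho_pos (x y : R) : 0 < x -> 0 < y -> 0 < rho x y.
Proof. intros; apply Rdiv_lt_0_compat; apply Rmult_lt_0_compat; lra. Qed.

Lemma coef_S (x y : R) (n : nat) :
  0 < x -> 0 < y ->
  coef x y (S n) =
  coef x y n * ((x + INR n) * (y + INR n) * (x + y / 2 + INR n)
     / ((1 + INR n) * (x + y + 1 + 2 * INR n) * (x + y + 2 + 2 * INR n))).
Proof.
  intros Hx Hy. unfold coef; cbn [poch pow].
  pose proof (pos_INR n).
  pose proof (poch_pos 1 n ltac:(lra)).
  pose proof (poch_pos ((x + y + 1) / 2) n ltac:(lra)).
  pose proof (poch_pos ((x + y) / 2 + 1) n ltac:(lra)).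
  field. repeat split; lra.
Qed.

Lemma coef_pos (x y : R) (n : nat) : 0 < x -> 0 < y -> 0 < coef x y n.
Proof.
  intros Hx Hy. unfold coef.
  apply Rmult_lt_0_compat; [apply pow_lt; lra|].
  apply Rdiv_lt_0_compat; repeat apply Rmult_lt_0_compat; apply poch_pos; lra.
Qed.

(** Raising [y] by 2 raises [y], [z] and [x + y + 1] by 2, 1 and 2, so each rising factorial changes
    only by its end factors. *)
Lemma coef_add_2 (x y : R) (n : nat) :
  0 < x -> 0 < y ->
  coef x (y + 2) n =
  coef x y n * ((y + INR n) * (y + INR n + 1) * (x + y / 2 + INR n)
                * ((x + y + 1) * (x + y + 2)))
  / (y * (y + 1) * (x + y / 2) * (x + y + 1 + 2 * INR n) * (x + y + 2 + 2 * INR n)).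
Proof.
  intros Hx Hy. induction n as [|n IH].
  - unfold coef; cbn. field. repeat split; lra.
  - rewrite coef_S, IH, coef_S, S_INR by lra. pose proof (pos_INR n).
    field. repeat split; lra.
Qed.

(** Ratio test with limit 1/4. The weight [(n + 1) ^ 2] dominates both the linear factor of
    [summand] and the factors of the telescoping certificates. *)
Lemma ex_series_coef_sqr (x y : R) :
  0 < x -> 0 < y -> ex_series (fun n => coef x y n * (INR n + 1) ^ 2).
Proof.
  intros Hx Hy. apply ex_series_Rabs.
  apply ex_series_DAlembert with (1 / 4); [lra| |].
  - intros n. pose proof (coef_pos x y n Hx Hy). pose proof (pos_INR n).
    apply Rgt_not_eq. apply Rmult_lt_0_compat; [lra|]. apply pow_lt; lra.
  (* The ratio is split into five affine quotients; the two numerators [n + 2] come from the squared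
     weight. *)
  - apply is_lim_seq_ext with (fun n =>
      (1 * INR n + x) / (1 * INR n + 1) * ((1 * INR n + y) / (1 * INR n + 1))
      * ((1 * INR n + (x + y / 2)) / (1 * INR n + 1))
      * ((1 * INR n + 2) / (2 * INR n + (x + y + 1)))
      * ((1 * INR n + 2) / (2 * INR n + (x + y + 2)))).
    + intros n. pose proof (coef_pos x y n Hx Hy). pose proof (pos_INR n).
      rewrite coef_S, S_INR by lra. rewrite Rabs_pos_eq.
      * field. repeat split; lra.
      * apply Rlt_le, Rdiv_lt_0_compat;
          repeat first [assumption | apply Rdiv_lt_0_compat | apply Rmult_lt_0_compat | apply pow_lt]; lra.
    + replace (Finite (1 / 4)) with (Finite (1 / 1 * (1 / 1) * (1 / 1) * (1 / 2) * (1 / 2)))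
        by (f_equal; field).
      repeat (apply is_lim_seq_mult'; [|apply is_lim_seq_affine_ratio; lra]);
        apply is_lim_seq_affine_ratio; lra.
Qed.

Lemma is_lim_seq_coef_mul (x y C : R) (c : nat -> R) :
  0 < x -> 0 < y ->
  (forall n, 0 <= c n <= C * (INR n + 1) ^ 2) ->
  is_lim_seq (fun n => coef x y n * c n) 0.
Proof.
  intros Hx Hy Hc.
  apply is_lim_seq_le_le with (fun _ => 0) (fun n => C * (coef x y n * (INR n + 1) ^ 2)).
  - intros n. pose proof (coef_pos x y n Hx Hy). specialize (Hc n). split; nra.
  - apply is_lim_seq_const.
  - replace (Finite 0) with (Finite (C * 0)) by (f_equal; ring).
    apply is_lim_seq_mult'; [apply is_lim_seq_const|].
    apply ex_series_lim_0, ex_series_coef_sqr; assumption.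
Qed.

Lemma summand_pos (x y : R) (n : nat) : 0 < x -> 0 < y -> 0 < summand x y n.
Proof.
  intros Hx Hy. pose proof (pos_INR n).
  apply Rmult_lt_0_compat; [apply coef_pos; assumption|lra].
Qed.

Lemma ex_series_summand (x y : R) : 0 < x -> 0 < y -> ex_series (summand x y).
Proof.
  intros Hx Hy.
  apply (@ex_series_le R_AbsRing R_CompleteNormedModule) with
    (fun n => (2 * x + y + 3) * (coef x y n * (INR n + 1) ^ 2)).
  - intros n. change (norm (summand x y n)) with (Rabs (summand x y n)).
    rewrite Rabs_pos_eq by (apply Rlt_le, summand_pos; assumption).
    unfold summand. pose proof (coef_pos x y n Hx Hy). pose proof (pos_INR n).
    assert (2 * x + y + 3 * INR n <= (2 * x + y + 3) * (INR n + 1) ^ 2) by nra.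
    nra.
  - apply (ex_series_scal_l (V := R_NormedModule) (2 * x + y + 3)).
    apply ex_series_coef_sqr; assumption.
Qed.

(** * Shifting [y] by 2, and the explicit sum at [y = 2] *)

(* The WZ mate of the summand is [2 n (n + x) / y] times the coefficient. *)
Lemma is_series_summand_add_2 (x y l : R) :
  0 < x -> 0 < y ->
  is_series (summand x y) l -> is_series (summand x (y + 2)) (l / rho x y).
Proof.
  intros Hx Hy Hl.
  set (G := fun n => coef x y n * (2 / y * (INR n * (INR n + x)))).
  (* [G O = 0] because of the factor [n], so the two series have equal sums. *)
  assert (HG : is_series (fun n => rho x y * summand x (y + 2) n - summand x y n) (G O)).
  { apply is_series_telescope.
    - intros n. unfold G, summand, rho. rewrite coef_add_2, coef_S, S_INR by lra.
      pose proof (pos_INR n). field. repeat split; lra.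
    - apply is_lim_seq_coef_mul with (2 / y * (1 + x)); [assumption|assumption|].
      intros n. pose proof (pos_INR n).
      assert (0 < 2 / y) by (apply Rdiv_lt_0_compat; lra).
      assert (0 <= INR n * (INR n + x) <= (1 + x) * (INR n + 1) ^ 2) by (split; nra).
      split; nra. }
  assert (Hrho := rho_pos x y Hx Hy).
  assert (H := is_series_scal_l (/ rho x y) _ _ (is_series_plus _ _ _ _ HG Hl)).
  replace (l / rho x y) with (scal (/ rho x y) (plus (G O) l)).
  2:{ unfold G, scal, plus; cbn; unfold mult; cbn. field; split; lra. }
  eapply is_series_ext; [|exact H].
  intros n. unfold scal, plus; cbn; unfold mult; cbn. field; lra.
Qed.

(* The limit case [y -> 0] of the same WZ pair. *)
Lemma is_series_summand_2 (x : R) :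
  0 < x -> is_series (summand x 2) ((x + 1) * (x + 2)).
Proof.
  intros Hx.
  (* For [n >= 1] this is the limit, as [y -> 0], of the mate divided by [rho x y], rewritten
     through [coef_add_2]; the same formula at [n = 0] gives the sum. *)
  set (K := fun n => coef x 2 n * ((x + 1 + 2 * INR n) * (x + 2 + 2 * INR n) / (INR n + 1))).
  replace ((x + 1) * (x + 2)) with (K O) by (unfold K, coef; cbn; field).
  apply is_series_telescope.
  - intros n. unfold K, summand. rewrite coef_S, S_INR by lra. pose proof (pos_INR n).
    field. repeat split; lra.
  - apply is_lim_seq_coef_mul with ((x + 2) * (x + 2)); [assumption|lra|].
    intros n. pose proof (pos_INR n). split.
    + apply Rlt_le, Rdiv_lt_0_compat; [apply Rmult_lt_0_compat|]; lra.
    + apply Rle_div_l; [lra|].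
      apply Rle_trans with ((x + 2) * (INR n + 1) * ((x + 2) * (INR n + 1)));
        [apply Rmult_le_compat; nra|].
      assert (0 <= ((x + 2) * (INR n + 1)) ^ 2) by apply pow2_ge_0. nra.
Qed.

(** * Monotonicity in [y] *)

Lemma Rdiv_le_cross (a b c d : R) : 0 < b -> 0 < d -> a * d <= c * b -> a / b <= c / d.
Proof.
  intros Hb Hd H. apply Rle_div_l; [lra|].
  replace (c / d * b) with (c * b / d) by (field; lra).
  apply Rle_div_r; lra.
Qed.

(** Induction on [n]: the ratio of consecutive coefficients increases with [y]. The bound [x <= 1]
    enters through [(x + u / 2 + n) / (x + u + 1 + 2 n)], whose derivative in [u] has the sign of
    [1 - x]. *)
Lemma coef_le (x y y' : R) (n : nat) :
  0 < x <= 1 -> 0 < y <= y' -> coef x y n <= coef x y' n.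
Proof.
  intros Hx Hy. induction n as [|n IH].
  - unfold coef; cbn. lra.
  - rewrite !coef_S by lra. pose proof (pos_INR n).
    pose proof (coef_pos x y n ltac:(lra) ltac:(lra)).
    assert (Hr : forall u, 0 < u ->
      (x + INR n) * (u + INR n) * (x + u / 2 + INR n)
      / ((1 + INR n) * (x + u + 1 + 2 * INR n) * (x + u + 2 + 2 * INR n))
      = (x + INR n) / (1 + INR n) * ((u + INR n) / (x + u + 2 + 2 * INR n)
        * ((x + u / 2 + INR n) / (x + u + 1 + 2 * INR n)))).
    { intros u Hu. field. repeat split; lra. }
    rewrite !Hr by lra.
    assert (Hp : forall u v, 0 < u -> 0 < v -> 0 <= u / v)
      by (intros u v Hu Hv; apply Rlt_le, Rdiv_lt_0_compat; assumption).
    apply Rmult_le_compat; [lra| |exact IH|].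
    + apply Rmult_le_pos; [|apply Rmult_le_pos]; apply Hp; lra.
    + apply Rmult_le_compat_l; [apply Hp; lra|].
      apply Rmult_le_compat; [apply Hp; lra|apply Hp; lra| |];
        apply Rdiv_le_cross; nra.
Qed.

Lemma is_series_summand_le (x y y' l l' : R) :
  0 < x <= 1 -> 0 < y <= y' ->
  is_series (summand x y) l -> is_series (summand x y') l' -> l <= l'.
Proof.
  intros Hx Hy Hl Hl'.
  rewrite <- (is_series_unique _ _ Hl), <- (is_series_unique _ _ Hl').
  apply Series_le; [|exists l'; exact Hl'].
  intros n. split; [apply Rlt_le, summand_pos; lra|].
  pose proof (pos_INR n). pose proof (coef_pos x y n ltac:(lra) ltac:(lra)).
  apply Rmult_le_compat; [lra|lra|apply coef_le; assumption|lra].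
Qed.

(** * Growth of [Q], here [quot] *)

Definition quot (n : nat) : R := poch (3 / 4) n / poch (1 / 4) n.

Lemma quot_pos (n : nat) : 0 < quot n.
Proof. apply Rdiv_lt_0_compat; apply poch_pos; lra. Qed.

Lemma quot_S (n : nat) : quot (S n) = quot n * ((INR n + 3 / 4) / (INR n + 1 / 4)).
Proof.
  unfold quot; cbn [poch]. pose proof (poch_pos (1 / 4) n ltac:(lra)).
  pose proof (pos_INR n). field. split; lra.
Qed.

(* [quot n ^ 2 / n] decreases while [quot n ^ 2 / (n + 1/8)] increases. *)
Lemma quot_add_bounds (n k : nat) :
  (0 < n)%nat ->
  quot (n + k) ^ 2 * INR n <= quot n ^ 2 * INR (n + k) /\
  quot n ^ 2 * (INR (n + k) + 1 / 8) <= quot (n + k) ^ 2 * (INR n + 1 / 8).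
Proof.
  intros Hn. apply lt_0_INR in Hn.
  assert (Hq := pow_lt _ 2 (quot_pos n)).
  induction k as [|k [IH1 IH2]].
  - rewrite Nat.add_0_r. split; lra.
  - rewrite Nat.add_succ_r, quot_S, S_INR, Rpow_mult_distr.
    assert (Hq' := pow_lt _ 2 (quot_pos (n + k))).
    assert (HN : 0 < INR (n + k)) by (rewrite plus_INR; pose proof (pos_INR k); lra).
    set (N := INR (n + k)) in *. set (p := quot (n + k) ^ 2) in *.
    set (q := quot n ^ 2) in *.
    set (s := ((N + 3 / 4) / (N + 1 / 4)) ^ 2).
    (* With denominators cleared, the right side exceeds the left by 1/16. *)
    assert (Hs1 : s * N <= N + 1).
    { unfold s. replace (((N + 3 / 4) / (N + 1 / 4)) ^ 2 * N)
        with ((N + 3 / 4) ^ 2 * N / (N + 1 / 4) ^ 2) by (field; lra).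
      apply Rle_div_l; [apply pow_lt; lra|nra]. }
    (* With denominators cleared, the difference is [N / 8]: the offset 1/8 makes the constant terms
       agree. *)
    assert (Hs2 : N + 1 + 1 / 8 <= s * (N + 1 / 8)).
    { unfold s. replace (((N + 3 / 4) / (N + 1 / 4)) ^ 2 * (N + 1 / 8))
        with ((N + 3 / 4) ^ 2 * (N + 1 / 8) / (N + 1 / 4) ^ 2) by (field; lra).
      apply Rle_div_r; [apply pow_lt; lra|nra]. }
    assert (Hs : 0 < s) by (apply pow_lt, Rdiv_lt_0_compat; lra).
    split.
    + apply Rmult_le_reg_r with N; [exact HN|].
      apply Rle_trans with (s * N * (q * N)).
      * replace (p * s * INR n * N) with (s * N * (p * INR n)) by ring.
        apply Rmult_le_compat_l; [nra|exact IH1].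
      * replace (q * (N + 1) * N) with ((N + 1) * (q * N)) by ring.
        apply Rmult_le_compat_r; [nra|exact Hs1].
    + apply Rmult_le_reg_r with (N + 1 / 8); [lra|].
      apply Rle_trans with (s * (N + 1 / 8) * (q * (N + 1 / 8))).
      * replace (q * (N + 1 + 1 / 8) * (N + 1 / 8))
          with ((N + 1 + 1 / 8) * (q * (N + 1 / 8))) by ring.
        apply Rmult_le_compat_r; [nra|exact Hs2].
      * replace (p * s * (INR n + 1 / 8) * (N + 1 / 8))
          with (s * (N + 1 / 8) * (p * (INR n + 1 / 8))) by ring.
        apply Rmult_le_compat_l; [nra|exact IH2].
Qed.

(** The case [k = n] of [quot_add_bounds]. Both ends tend to 2, which is the source of [sqrt 2]. *)
Lemma quot_double_bounds (n : nat) :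
  (0 < n)%nat ->
  (16 * INR n + 1) / (8 * INR n + 1) <= (quot (2 * n) / quot n) ^ 2 <= 2.
Proof.
  intros Hn. destruct (quot_add_bounds n n Hn) as [H1 H2].
  replace (n + n)%nat with (2 * n)%nat in H1, H2 by lia.
  rewrite mult_INR in H1, H2. cbn [INR] in H1, H2.
  apply lt_0_INR in Hn. assert (Hq := pow_lt _ 2 (quot_pos n)).
  replace ((quot (2 * n) / quot n) ^ 2) with (quot (2 * n) ^ 2 / quot n ^ 2)
    by (pose proof (quot_pos n); field; lra).
  split.
  - apply Rdiv_le_cross; lra.
  - apply Rle_div_l; [lra|].
    apply Rmult_le_reg_r with (INR n); lra.
Qed.

(** * Explicit approximants and the sandwich *)

Definition corr (t : R) : R :=
  (4 * t + 1) * (8 * t + 3) * (8 * t + 7) * (8 * t + 11)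
  / ((8 * t + 5) * (8 * t + 1) * (8 * t + 9) * (4 * t + 3)).

(** Closed form of [S (3/4) 2] times the product over [j < n] of [rho (3/4) (3/2 + 2 j) / rho (3/4)
    (2 + 2 j)]. That product is [(15/4)_(2n) (5/4)_n / ((13/4)_(2n) (7/4)_n)]; lowering the
    parameters to 3/4 and 1/4 leaves [corr] and the constant 45/16. *)
Definition approx (n : nat) : R :=
  45 / 16 * (quot (2 * n) / quot n) * corr (INR n).

Lemma approx_S (n : nat) :
  approx (S n) * rho (3 / 4) (2 + 2 * INR n)
  = approx n * rho (3 / 4) (3 / 2 + 2 * INR n).
Proof.
  unfold approx, corr, rho.
  replace (2 * S n)%nat with (S (S (2 * n))) by lia.
  rewrite !quot_S, !S_INR, mult_INR. cbn [INR].
  pose proof (pos_INR n). pose proof (quot_pos n). field.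
  repeat split; lra.
Qed.

(** Each shift divides [s] and [v] by their own [rho], so [u * v / s] gains the same quotient of
    [rho] values as [approx]. *)
Lemma is_series_summand_pair (u : R) (n : nat) :
  is_series (summand (3 / 4) (3 / 2)) u ->
  exists s v : R,
    is_series (summand (3 / 4) (3 / 2 + 2 * INR n)) s /\
    is_series (summand (3 / 4) (2 + 2 * INR n)) v /\
    u * v = s * approx n.
Proof.
  intros Hu. induction n as [|n (s & v & Hs & Hv & E)].
  - exists u, ((3 / 4 + 1) * (3 / 4 + 2)). cbn [INR].
    rewrite Rmult_0_r, !Rplus_0_r. split; [exact Hu|].
    split; [apply is_series_summand_2; lra|].
    unfold approx, corr, quot; cbn. field.
  - pose proof (pos_INR n).
    exists (s / rho (3 / 4) (3 / 2 + 2 * INR n)), (v / rho (3 / 4) (2 + 2 * INR n)).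
    rewrite S_INR.
    replace (3 / 2 + 2 * (INR n + 1)) with (3 / 2 + 2 * INR n + 2) by ring.
    replace (2 + 2 * (INR n + 1)) with (2 + 2 * INR n + 2) by ring.
    split; [apply is_series_summand_add_2; lra || exact Hs|].
    split; [apply is_series_summand_add_2; lra || exact Hv|].
    assert (HA := approx_S n).
    pose proof (rho_pos (3 / 4) (3 / 2 + 2 * INR n) ltac:(lra) ltac:(lra)).
    pose proof (rho_pos (3 / 4) (2 + 2 * INR n) ltac:(lra) ltac:(lra)).
    replace (u * (v / rho (3 / 4) (2 + 2 * INR n)))
      with (u * v / rho (3 / 4) (2 + 2 * INR n)) by (field; lra).
    rewrite E.
    replace (approx (S n)) with (approx n * rho (3 / 4) (3 / 2 + 2 * INR n)
      / rho (3 / 4) (2 + 2 * INR n)) by (rewrite <- HA; field; lra).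
    field; lra.
Qed.

(** Here [u = approx n * (s / v)], and monotonicity along [3/2 + 2 n <= 2 + 2 n <= 3/2 + 2 n + 2]
    gives [s <= v <= s / rho], so [s / v] lies between [rho] and 1. *)
Lemma approx_sandwich (u : R) (n : nat) :
  is_series (summand (3 / 4) (3 / 2)) u ->
  approx n * rho (3 / 4) (3 / 2 + 2 * INR n) <= u <= approx n.
Proof.
  intros Hu. destruct (is_series_summand_pair u n Hu) as (s & v & Hs & Hv & E).
  pose proof (pos_INR n).
  pose proof (rho_pos (3 / 4) (3 / 2 + 2 * INR n) ltac:(lra) ltac:(lra)) as Hr.
  assert (Hs' := is_series_summand_add_2 (3 / 4) (3 / 2 + 2 * INR n) s
    ltac:(lra) ltac:(lra) Hs).
  assert (Hsv : s <= v)
    by (refine (is_series_summand_le _ _ _ _ _ _ _ Hs Hv); lra).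
  assert (Hvs : v <= s / rho (3 / 4) (3 / 2 + 2 * INR n))
    by (refine (is_series_summand_le _ _ _ _ _ _ _ Hv Hs'); lra).
  apply Rle_div_r in Hvs; [|exact Hr].
  assert (Hv0 : 0 < v).
  { apply Rlt_le_trans with ((3 / 4 + 1) * (3 / 4 + 2)); [lra|].
    refine (is_series_summand_le _ 2 _ _ _ _ _ (is_series_summand_2 _ _) Hv); lra. }
  assert (HA : 0 < approx n).
  { unfold approx, corr. pose proof (quot_pos n). pose proof (quot_pos (2 * n)).
    repeat first [assumption | apply Rdiv_lt_0_compat | apply Rmult_lt_0_compat]; lra. }
  split; apply Rmult_le_reg_r with v; nra.
Qed.

(** * Passage to the limit and specialization *)

Lemma is_lim_seq_corr : is_lim_seq (fun n => corr (INR n)) 1.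
Proof.
  apply is_lim_seq_ext with (fun n =>
    (4 * INR n + 1) / (4 * INR n + 3) * ((8 * INR n + 3) / (8 * INR n + 5))
    * ((8 * INR n + 7) / (8 * INR n + 1)) * ((8 * INR n + 11) / (8 * INR n + 9))).
  - intros n. unfold corr. pose proof (pos_INR n). field. repeat split; lra.
  - replace (Finite 1) with (Finite (4 / 4 * (8 / 8) * (8 / 8) * (8 / 8)))
      by (f_equal; field).
    repeat (apply is_lim_seq_mult'; [|apply is_lim_seq_affine_ratio; lra]);
        apply is_lim_seq_affine_ratio; lra.
Qed.

Lemma is_lim_seq_rho (x y : R) :
  0 < x -> 0 < y -> is_lim_seq (fun n => rho x (y + 2 * INR n)) 1.
Proof.
  intros Hx Hy.
  apply is_lim_seq_ext with (fun n =>
    (2 * INR n + (y + 1)) / (2 * INR n + (x + y + 1))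
    * ((2 * INR n + (2 * x + y)) / (2 * INR n + (x + y + 2)))).
  - intros n. unfold rho. pose proof (pos_INR n). field. repeat split; lra.
  - replace (Finite 1) with (Finite (2 / 2 * (2 / 2))) by (f_equal; field).
    apply is_lim_seq_mult'; apply is_lim_seq_affine_ratio; lra.
Qed.

Lemma is_series_summand_three_quarters :
  is_series (summand (3 / 4) (3 / 2)) (45 * sqrt 2 / 16).
Proof.
  destruct (ex_series_summand (3 / 4) (3 / 2)) as [u Hu]; [lra|lra|].
  assert (Hu0 : 0 < u).
  { destruct (approx_sandwich u 0 Hu) as [H _]. unfold approx, corr, quot, rho in H.
    cbn in H. lra. }
  (* The sandwich is squared because the bounds on [quot] concern squares; as a squeeze on a
     constant sequence it determines [u ^ 2], and [u > 0] then selects the root. *)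
  assert (Hsq : is_lim_seq (fun _ => u ^ 2) ((45 / 16) ^ 2 * 2)).
  { apply is_lim_seq_le_le_loc with
      (fun n => (45 / 16) ^ 2 * ((16 * INR n + 1) / (8 * INR n + 1))
                * (corr (INR n) * corr (INR n))
                * (rho (3 / 4) (3 / 2 + 2 * INR n) * rho (3 / 4) (3 / 2 + 2 * INR n)))
      (fun n => (45 / 16) ^ 2 * 2 * (corr (INR n) * corr (INR n))).
    - exists 1%nat. intros n Hn.
      destruct (approx_sandwich u n Hu) as [Hl Hr].
      destruct (quot_double_bounds n Hn) as [Ql Qr].
      pose proof (pos_INR n).
      pose proof (rho_pos (3 / 4) (3 / 2 + 2 * INR n) ltac:(lra) ltac:(lra)) as Hrho.
      assert (HA : approx n ^ 2
        = (45 / 16) ^ 2 * (quot (2 * n) / quot n) ^ 2 * (corr (INR n) * corr (INR n)))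
        by (unfold approx; ring).
      assert (Hc : 0 <= corr (INR n) * corr (INR n)) by nra.
      split.
      + apply Rle_trans with ((approx n * rho (3 / 4) (3 / 2 + 2 * INR n)) ^ 2).
        * rewrite Rpow_mult_distr, HA.
          replace (rho (3 / 4) (3 / 2 + 2 * INR n) ^ 2) with
            (rho (3 / 4) (3 / 2 + 2 * INR n) * rho (3 / 4) (3 / 2 + 2 * INR n)) by ring.
          apply Rmult_le_compat_r; [nra|]. apply Rmult_le_compat_r; [exact Hc|].
          apply Rmult_le_compat_l; [lra|exact Ql].
        * apply pow_incr. split; [|exact Hl].
          apply Rmult_le_pos; lra.
      + apply Rle_trans with (approx n ^ 2).
        * apply pow_incr; lra.
        * rewrite HA. apply Rmult_le_compat_r; [exact Hc|].
          apply Rmult_le_compat_l; [lra|exact Qr].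
    - replace (Finite ((45 / 16) ^ 2 * 2)) with
        (Finite ((45 / 16) ^ 2 * (16 / 8) * (1 * 1) * (1 * 1))) by (f_equal; field).
      apply is_lim_seq_mult'; [apply is_lim_seq_mult'; [apply is_lim_seq_mult'|]|].
      + apply is_lim_seq_const.
      + apply is_lim_seq_affine_ratio; lra.
      + apply is_lim_seq_mult'; apply is_lim_seq_corr.
      + apply is_lim_seq_mult'; apply is_lim_seq_rho; lra.
    - replace (Finite ((45 / 16) ^ 2 * 2)) with
        (Finite ((45 / 16) ^ 2 * 2 * (1 * 1))) by (f_equal; field).
      apply is_lim_seq_mult'; [apply is_lim_seq_const|].
      apply is_lim_seq_mult'; apply is_lim_seq_corr. }
  apply is_lim_seq_unique in Hsq. rewrite Lim_seq_const in Hsq.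
  injection Hsq as Hsq.
  replace (45 * sqrt 2 / 16) with u; [exact Hu|].
  apply Rsqr_inj; [lra|pose proof (sqrt_pos 2); lra|].
  unfold Rsqr. replace (45 * sqrt 2 / 16 * (45 * sqrt 2 / 16))
    with ((45 / 16) ^ 2 * (sqrt 2 * sqrt 2)) by field.
  rewrite sqrt_sqrt; lra.
Qed.

(* is_series a l: the partial sums of a converge to l. *)
Theorem mainTheorem5 :
  is_series
    (fun k : nat =>
       (1 / 4) ^ k
       * ((poch (3 / 4) k * poch (3 / 2) k * poch (3 / 2) k)
          / (poch 1 k * poch (13 / 8) k * poch (17 / 8) k))
       * (INR k + 1))
    (15 * sqrt 2 / 16).
Proof.
  (* At [x = 3/4], [y = 3/2] the linear factor is [3 (n + 1)], hence the scaling by 1/3, and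
     [z = y], hence the repeated [(3/2)_k]. *)
  assert (H := is_series_scal_l (/ 3) _ _ is_series_summand_three_quarters).
  replace (15 * sqrt 2 / 16) with (scal (/ 3) (45 * sqrt 2 / 16))
    by (unfold scal; cbn; unfold mult; cbn; field).
  eapply is_series_ext; [|exact H].
  intros n. unfold scal; cbn; unfold mult; cbn. unfold summand, coef.
  replace (3 / 4 + 3 / 2 / 2) with (3 / 2) by field.
  replace ((3 / 4 + 3 / 2 + 1) / 2) with (13 / 8) by field.
  replace ((3 / 4 + 3 / 2) / 2 + 1) with (17 / 8) by field.
  field. repeat split; apply Rgt_not_eq, poch_pos; lra.
Qed.
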